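(* The pseudoarc $P$ is elastically chainable: there is a natural number $m$ such that for every natural number $n$ there is an open cover of $P$ of size $m$ for which every chain refinement has at least $n$ members.
   Context: The pseudoarc is the (up to homeomorphism unique) nondegenerate metric continuum that is both chainable and hereditarily indecomposable. A continuum is a nonempty compact connected Hausdorff space; it is hereditarily indecomposable if no subcontinuum is the union of two proper subcontinua of itself. A chain refinement of an open cover $\mathcal{U}$ of a space is a finite indexed open cover $\{V_i:i<k\}$ of the space that refines $\mathcal{U}$ (each $V_i$ is contained in some member of $\mathcal{U}$) and satisfies $V_i\cap V_j\neq\emptyset$ if and only if $|i-j|\le 1$; its size (number of members) is $k$. A continuum is chainable if every finite open cover of it has a chain refinement. *)

(* Defs.v *)
From HB Require Import structures.
From mathcomp Require Import all_boot all_order all_algebra.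
From mathcomp Require Import all_classical all_reals all_analysis.

Set Implicit Arguments.
Unset Strict Implicit.
Unset Printing Implicit Defensive.

Import Order.TTheory GRing.Theory Num.Theory.

Local Open Scope classical_set_scope.
Local Open Scope ring_scope.

Definition continuum (T : topologicalType) : Prop :=
  [/\ [set: T] !=set0, compact [set: T], connected [set: T]
    & hausdorff_space T].

(* [compact] and [connected] of a set [K] refer to its subspace topology. In a
   Hausdorff space [K] is itself Hausdorff, so these are exactly the subsets
   that are continua as subspaces. *)
Definition subcontinuum (T : topologicalType) (K : set T) : Prop :=
  [/\ K !=set0, compact K & connected K].

Definition hereditarily_indecomposable (T : topologicalType) : Prop :=
  forall K : set T, subcontinuum K ->
    ~ exists A B : set T,
        [/\ subcontinuum A, subcontinuum B, A `<` K, B `<` K & K = A `|` B].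

Definition open_cover (T : topologicalType) (U : set (set T)) : Prop :=
  (forall A, U A -> open A) /\ \bigcup_(A in U) A = [set: T].

(* With [i = j] the last clause makes every [V i] nonempty. *)
Definition chain_refinement (T : topologicalType) (U : set (set T))
    (k : nat) (V : 'I_k -> set T) : Prop :=
  [/\ forall i, open (V i),
      \bigcup_i V i = [set: T],
      forall i, exists2 A, U A & V i `<=` A
    & forall i j : 'I_k,
        V i `&` V j !=set0 <-> `|(i : nat)%:Z - (j : nat)%:Z| <= 1].

Definition chainable (T : topologicalType) : Prop :=
  forall U : set (set T), open_cover U -> finite_set U ->
    exists (k : nat) (V : 'I_k -> set T), chain_refinement U V.

Definition pseudoarc (R : realType) (P : metricType R) : Prop :=
  [/\ continuum P, exists x y : P, x <> y, chainable P
    & hereditarily_indecomposable P].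

(* The size of a cover is its number of distinct members. *)
Definition elastically_chainable (T : topologicalType) : Prop :=
  exists m : nat, forall n : nat,
    exists U : set (set T),
      [/\ open_cover U, (U #= `I_m)%card
        & forall (k : nat) (V : 'I_k -> set T),
            chain_refinement U V -> (n <= k)%N].

(* Main.v *)
Require Import Defs.
From mathcomp Require Import all_boot all_order all_algebra.
From mathcomp Require Import all_classical all_reals all_analysis.
From mathcomp Require Import lra zify.

(** Every nondegenerate connected metric space is elastically chainable with
    [m = 3]. A scaled distance function [g] is surjective onto a long interval;
    composed with the covering [R -> R / 3Z] it pulls the three arcs of length 2
    centred at 0, 1, 2 back to a cover of size 3. A chain refinement of this
    cover lifts, link by link, to a chain of intervals [(s i - 1, s i + 1)] with
    consecutive integer centres at most 1 apart; by connectedness [g] takes its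
    values in one translate of the lifted chain, so the number of links bounds
    the length of the range of [g]. *)

Set Implicit Arguments.
Unset Strict Implicit.
Unset Printing Implicit Defensive.

Import Order.TTheory GRing.Theory Num.Theory.
Import numFieldNormedType.Exports.

Local Open Scope classical_set_scope.
Local Open Scope ring_scope.

(** Path lifting from Z/3 to Z: any two residues mod 3 differ by -1, 0 or 1, so every sequence of
    residues lifts with steps of at most 1. *)
Lemma lift_mod3 (c : nat -> int) :
  exists s : nat -> int,
    (forall i, exists r : int, c i = s i + 3 * r) /\
    (forall i, `|s i.+1 - s i| <= 1).
Proof.
(* The increment is the representative of [c j.+1 - s j] mod 3 in {-1, 0, 1}. *)
pose fix s i := if i is j.+1 then s j + (((c j.+1 - s j + 1) %% 3)%Z - 1)
                else c 0%N.
exists s; split=> [[|i]|i] /=.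
- by exists 0; lia.
- by exists ((c i.+1 - s i + 1) %/ 3)%Z; have := divz_eq (c i.+1 - s i + 1) 3; lia.
- have h1 := @modz_ge0 (c i.+1 - s i + 1) 3 isT.
  by have h2 := @ltz_mod (c i.+1 - s i + 1) 3 isT; lia.
Qed.

Lemma int_1lipschitz (s : nat -> int) (hs : forall i, `|s i.+1 - s i| <= 1)
  (i j : nat) : `|s i - s j| <= `|i%:Z - j%:Z|.
Proof.
wlog ij : i j / (i <= j)%N.
  by move=> W; have [/W//|/ltnW/W] := leqP i j; lia.
rewrite -(subnKC ij); elim: (j - i)%N => [|d IH]; first by rewrite addn0; lia.
by rewrite addnS; have := hs (i + d)%N; lia.
Qed.

Section Mod3Arc.
Variable R : realType.

(** The preimage in R of the arc about [t] in R / 3Z; quantifying over [q] replaces the quotient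
    circle. *)
Definition mod3_arc (t : int) : set R :=
  [set x | exists q : int, `|x - (t + 3 * q)%:~R| < 1].

Lemma mod3_arc_eq (s t r : int) : t = s + 3 * r -> mod3_arc t = mod3_arc s.
Proof.
move=> ->; apply/seteqP; split=> x [q hq].
  by exists (r + q); rewrite mulrDr addrA.
by exists (q - r); rewrite mulrBr -addrA [3 * r + _]addrC subrK.
Qed.

Lemma open_near_int (z : int) : open [set x : R | `|x - z%:~R| < 1].
Proof.
rewrite (_ : [set x | _] = ball (z%:~R : R) 1); first exact: ball_open.
by apply/seteqP; split=> x; rewrite /ball /= distrC.
Qed.

Lemma open_mod3_arc t : open (mod3_arc t).
Proof.
rewrite (_ : mod3_arc t =
  \bigcup_(q in setT) [set x | `|x - (t + 3 * q)%:~R| < 1]).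
  by apply: bigcup_open => q _; exact: open_near_int.
by apply/seteqP; split=> x [q]; [exists q | exists q].
Qed.

Lemma mod3_arc_cover x : exists t : 'I_3, mod3_arc (t : nat)%:Z x.
Proof.
set z := Num.floor x.
have tlt : (`|(z %% 3)%Z| < 3)%N.
  by have := @modz_ge0 z 3 isT; have := @ltz_mod z 3 isT; lia.
exists (Ordinal tlt); exists (z %/ 3)%Z => /=.
have -> : `|(z %% 3)%Z|%:Z + 3 * (z %/ 3)%Z = z.
  by have := @modz_ge0 z 3 isT; have := divz_eq z 3; lia.
have := floor_itv x; rewrite -/z intrD => /andP[? ?].
by rewrite ltr_norml; apply/andP; split; lra.
Qed.

Lemma near_int_lt (x : R) (a b : int) :
  `|x - a%:~R| < 1 -> `|x - b%:~R| < 1 -> `|a - b| < 2.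
Proof.
move=> ha hb; rewrite -(ltr_int R) intr_norm intrB.
have := ler_distD x a%:~R b%:~R; rewrite [`|a%:~R - x|]distrC; lra.
Qed.

(** An open interval of radius 1 about an integer contains no other integer, so the values 0, 1, 2
    tell the three arcs apart. *)
Lemma mod3_arc_int (t u : 'I_3) : mod3_arc (t : nat)%:Z ((u : nat)%:R) -> u = t.
Proof.
case=> q; rewrite -[(u : nat)%:R]/((u : nat)%:Z%:~R) -intrB -intr_norm.
rewrite -[1]/(1%:~R) ltr_int => h; apply: val_inj => /=.
by have := ltn_ord t; have := ltn_ord u; lia.
Qed.

End Mod3Arc.

(** Each [B i] is clopen, its complement being the union of the other members. *)
Lemma connected_fibers (T : topologicalType) (I : Type) (B : I -> set T) :
  connected [set: T] -> (forall i, open (B i)) ->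
  (forall x, exists i, B i x) -> (forall i j x, B i x -> B j x -> i = j) ->
  forall x y i, B i x -> B i y.
Proof.
move=> Tconn Bo Bcov Bdisj x y i Bix.
suff -> : B i = setT by [].
apply: Tconn; first by exists x.
  by exists (B i); rewrite ?setTI.
exists (B i); rewrite ?setTI //; rewrite -openC.
rewrite (_ : ~` B i = \bigcup_(j in [set j | j <> i]) B j).
  by apply: bigcup_open => j _; exact: Bo.
apply/seteqP; split=> z /=.
  by have [j Bjz] := Bcov z; move=> nBz; exists j => // ji; apply: nBz; rewrite -ji.
by case=> j /= ji Bjz Biz; apply: ji; exact: Bdisj Bjz Biz.
Qed.

Lemma chain_refinement_range (R : realType) (T : topologicalType) (g : T -> R)
    (k : nat) (V : 'I_k -> set T) (x y : T) :
  connected [set: T] -> continuous g ->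
  chain_refinement [set g @^-1` mod3_arc (t : nat)%:Z | t in [set: 'I_3]] V ->
  `|g x - g y| < k.+1%:R.
Proof.
move=> Tconn gc [Vo Vcov Vsub Vadj].
have Vcovx z : exists i, V i z.
  by have : [set: T] z by []; rewrite -Vcov => -[i]; exists i.
(* Centres are indexed by all of [nat] so that they lift as a sequence; past the last link the
   default 0 satisfies the condition vacuously. *)
have /choice[c hc] (i : nat) :
    exists t : int, forall o : 'I_k, o = i :> nat -> V o `<=` g @^-1` mod3_arc t.
  have [ik|ki] := ltnP i k; last first.
    by exists 0 => o oi; have := ltn_ord o; lia.
  have [_ [t _ <-] Vt] := Vsub (Ordinal ik).
  by exists (t : nat)%:Z => o oi; rewrite (_ : o = Ordinal ik) //; apply: val_inj.
have [s [sc s1]] := lift_mod3 c.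
(* [B q] is the sheet where [g] follows the lifted chain translated by 3 [q]. *)
pose B (q : int) := \bigcup_i (V i `&` g @^-1` [set r | `|r - (s i + 3 * q)%:~R| < 1]).
have Bo q : open (B q).
  apply: bigcup_open => i _; apply: openI; first exact: Vo.
  by apply: open_comp => [z _|]; [exact: gc | exact: open_near_int].
have Bcov z : exists q, B q z.
  have [i Viz] := Vcovx z; have [r cr] := sc i.
  have := hc _ _ erefl _ Viz; rewrite (mod3_arc_eq _ cr) => -[q hq].
  by exists q; exists i.
(* Meeting links have [s i], [s j] at most 1 apart, whereas sheets are 3 apart. *)
have Bdisj q r z : B q z -> B r z -> q = r.
  case=> i _ [Viz iz] [j _ [Vjz jz]].
  have /Vadj ij : V i `&` V j !=set0 by exists z.
  by have := near_int_lt iz jz; have := int_1lipschitz s1 i j; lia.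
have [q Bqx] := Bcov x.
have [j _ [_ jy]] := connected_fibers Tconn Bo Bcov Bdisj y Bqx.
case: Bqx => i _ [_ ix].
(* The shift 3 [q] is common to [x] and [y] and cancels; indices below [k] differ by at most [k] -
   1, and the two radii add 2. *)
have : `|s i - s j| + 2 <= k.+1%:Z.
  by have := int_1lipschitz s1 i j; have := ltn_ord i; have := ltn_ord j; lia.
rewrite -(ler_int R) intrD intr_norm intrB; apply: lt_le_trans.
move: ix jy => /=; rewrite !intrD !ltr_norml => /andP[? ?] /andP[? ?].
have := ler_norm ((s i)%:~R - (s j)%:~R : R).
have := ler_norm ((s j)%:~R - (s i)%:~R : R); rewrite distrC => ? ?.
by apply/andP; split; lra.
Qed.

Lemma mdist_continuous (R : realType) (M : metricType R) (a : M) :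
  continuous (mdist a : M -> R).
Proof.
move=> x; apply/cvgrPdist_lt => e e0.
have : nbhs x (ball x e) by exact: nbhsx_ballx.
apply: filterS => y; rewrite ballEmdist /= => xy.
have h1 := metric_triangle a y x; have h2 := metric_triangle a x y.
rewrite (metric_sym y x) in h1.
by rewrite ltr_norml; apply/andP; split; lra.
Qed.

Lemma elastically_chainable_connected (R : realType) (M : metricType R) (a b : M) :
  a <> b -> connected [set: M] -> elastically_chainable M.
Proof.
move=> ab Mconn; exists 3%N => n.
have ab0 : 0 < mdist a b by rewrite mdist_gt0; exact/eqP.
(* Scaled to run from 0 at [a] to [n] + 2 at [b]: the range bound then forces [k] > [n], and the
   values 0, 1, 2 are attained even for [n] = 0. *)
pose g x := n.+2%:R / mdist a b * mdist a x.
have gc : continuous g.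
  by move=> x; apply: cvgM; [exact: cvg_cst | exact: mdist_continuous].
have ga : g a = 0 by rewrite /g mdistxx mulr0.
have gb : g b = n.+2%:R by rewrite /g divfK ?gt_eqF.
have gsurj (u : 'I_3) : exists x, g x = (u : nat)%:R.
  have /connected_intervalP gI : connected [set g x | x in [set: M]].
    by apply: connected_continuous_connected => //; exact: continuous_subspaceT.
  have [x _ gx] : [set g x | x in [set: M]] (u : nat)%:R.
    apply: (gI (g a) (g b)); [by exists a | by exists b |].
    by rewrite ga gb ler0n ler_nat; have := ltn_ord u; lia.
  by exists x.
exists [set g @^-1` mod3_arc (t : nat)%:Z | t in [set: 'I_3]]; split.
- split=> [_ [t _ <-]|].
    by apply: open_comp => [z _|]; [exact: gc | exact: open_mod3_arc].
  apply/seteqP; split=> // x _; have [t gx] := mod3_arc_cover (g x).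
  by exists (g @^-1` mod3_arc (t : nat)%:Z) => //; exists t.
- rewrite (card_eqr card_II); apply: inj_card_eq => t u _ _ tu.
  have [x gx] := gsurj u.
  (* Equal preimages put a point of value [u] into the arc about [t]. *)
  suff : mod3_arc (t : nat)%:Z (g x) by rewrite gx => /mod3_arc_int.
  change ((g @^-1` mod3_arc (t : nat)%:Z) x); rewrite tu /=.
  by rewrite gx; exists 0; rewrite mulr0 addr0 subrr normr0.
- move=> k V /(chain_refinement_range b a Mconn gc).
  by rewrite ga gb subr0 normr_nat ltr_nat; lia.
Qed.

Theorem mainTheorem2 (R : realType) (P : metricType R) (hP : pseudoarc P) :
  elastically_chainable P.
Proof.
case: hP => -[_ _ Pconn _] [a [b ab]] _ _.
exact: elastically_chainable_connected ab Pconn.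
Qed.
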